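(* Let $K$ be a compact set in $\mathbb{R}^2$ with rectifiable boundary of finite length. Then $R_\theta\chi_K$ is absolutely continuous for all but countably many $\theta\in S^1$.
   Context: For $\theta\in S^1$ (the unit circle in $\mathbb{R}^2$), $R_\theta\chi_K$ is the Radon transform of the characteristic function of $K$ in direction $\theta$: $(R_\theta\chi_K)(r)=\lambda^1(K\cap\{x\in\mathbb{R}^2:\langle x,\theta\rangle=r\})$ for $r\in\mathbb{R}$, where $\lambda^1$ is one-dimensional Lebesgue measure on lines. The length of a set is its $1$-dimensional Hausdorff measure $\mathcal{H}^1$. A set is rectifiable if it can be covered by countably many Lipschitz curves and an $\mathcal{H}^1$-null set. *)

(* Defs.v *)
From HB Require Import structures.
From mathcomp Require Import all_boot all_order all_algebra.
From mathcomp Require Import all_classical all_reals all_analysis.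
From mathcomp Require Import ring.
Import Order.TTheory GRing.Theory Num.Theory.
Import numFieldNormedType.Exports.

Set Implicit Arguments.
Unset Strict Implicit.
Unset Printing Implicit Defensive.

Local Open Scope classical_set_scope.
Local Open Scope ring_scope.

(* The plane is R * R: its library topology is the usual one, but its library
   norm is the sup norm, so the Euclidean structure is given explicitly. *)

Definition dot2 (R : realType) (x y : R * R) : R := x.1 * y.1 + x.2 * y.2.

Definition edist2 (R : realType) (x y : R * R) : R :=
  Num.sqrt (dot2 (x - y) (x - y)).

Definition unit_circle (R : realType) : set (R * R) :=
  [set theta | dot2 theta theta = 1].
Arguments unit_circle : clear implicits.

Definition boundary (T : topologicalType) (A : set T) : set T :=
  closure A `\` interior A.

(* The maximum with 0 makes the diameter of the empty set 0 instead of -oo. *)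
Definition ediam (R : realType) (A : set (R * R)) : \bar R :=
  maxe 0%E (ereal_sup [set (edist2 xy.1 xy.2)%:E | xy in A `*` A]).

Definition hausdorff1_delta (R : realType) (delta : R) (A : set (R * R)) :
    \bar R :=
  ereal_inf [set (\sum_(0 <= i <oo) ediam (U i))%E | U in
    [set U : nat -> set (R * R) |
      A `<=` \bigcup_i U i /\ forall i, (ediam (U i) <= delta%:E)%E]].

Definition hausdorff1 (R : realType) (A : set (R * R)) : \bar R :=
  ereal_sup [set hausdorff1_delta delta A | delta in [set d : R | 0 < d]].

(* Being Lipschitz for some constant does not depend on whether the plane
   carries the sup norm or the Euclidean norm. *)
Definition lipschitz_curve (R : realType) (C : set (R * R)) : Prop :=
  exists2 g : R -> R * R,
    [lipschitz g t | t in `[0, 1]] & C = g @` `[0, 1].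

Definition rectifiable (R : realType) (A : set (R * R)) : Prop :=
  exists (C : nat -> set (R * R)) (N : set (R * R)),
    [/\ forall i, lipschitz_curve (C i), hausdorff1 N = 0%E &
        A `<=` (\bigcup_i C i) `|` N].

Definition line2 (R : realType) (theta : R * R) (r : R) : set (R * R) :=
  [set x | dot2 x theta = r].

(* Arc-length parametrization of [line2 theta r] for theta on the unit circle,
   starting from the foot point r * theta. *)
Definition line_param (R : realType) (theta : R * R) (r t : R) : R * R :=
  (r * theta.1 - t * theta.2, r * theta.2 + t * theta.1).

Lemma range_line_param (R : realType) (theta : R * R) (r : R) :
  unit_circle R theta -> range (line_param theta r) = line2 theta r.
Proof.
rewrite /unit_circle /line2 /line_param /dot2 /= => h.
apply/seteqP; split => [_ [t _ <-]|[x y] /= hr] /=.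
  by transitivity (r * (theta.1 * theta.1 + theta.2 * theta.2));
    [ring | rewrite h mulr1].
exists (y * theta.1 - x * theta.2) => //; rewrite -hr; congr pair.
- by transitivity (x * (theta.1 * theta.1 + theta.2 * theta.2));
    [ring | rewrite h mulr1].
- by transitivity (y * (theta.1 * theta.1 + theta.2 * theta.2));
    [ring | rewrite h mulr1].
Qed.

Lemma edist2_line_param (R : realType) (theta : R * R) (r s t : R) :
  unit_circle R theta ->
  edist2 (line_param theta r s) (line_param theta r t) = `|s - t|.
Proof.
rewrite /unit_circle /edist2 /line_param /dot2 /= => h.
rewrite -sqrtr_sqr; congr Num.sqrt.
by transitivity ((s - t) ^+ 2 * (theta.1 * theta.1 + theta.2 * theta.2));
  [ring | rewrite h mulr1].
Qed.

(* One-dimensional Lebesgue measure on the line [line2 theta r]. *)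
Definition line_measure (R : realType) (theta : R * R) (r : R)
    (A : set (R * R)) : \bar R :=
  lebesgue_measure (line_param theta r @^-1` A).

(* Radon transform of the characteristic function of K in direction theta;
   the measure is finite when K is bounded, so [fine] loses nothing there. *)
Definition radon_indic (R : realType) (theta : R * R) (K : set (R * R))
    (r : R) : R :=
  fine (line_measure theta r (K `&` line2 theta r)).

Definition absolutely_continuous (R : realType) (f : R -> R) : Prop :=
  forall eps : R, 0 < eps -> exists2 delta : R, 0 < delta &
    forall (n : nat) (a b : 'I_n -> R),
      (forall i, a i <= b i) ->
      trivIset [set: 'I_n] (fun i => `]a i, b i[%classic) ->
      \sum_(i < n) (b i - a i) < delta ->
      \sum_(i < n) `|f (b i) - f (a i)| < eps.

(* Main.v *)
Require Import Defs.
From HB Require Import structures.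
From mathcomp Require Import all_boot all_order all_algebra.
From mathcomp Require Import all_classical all_reals all_analysis.
From mathcomp Require Import ring lra.
Import Order.TTheory GRing.Theory Num.Theory.
Import numFieldNormedType.Exports.

(** Write B for the boundary of K and f for the Radon transform in a direction
    u.  If a point t of the line at height a lies in K while the parallel point
    at height b does not, the segment between them meets B.  The slices of K at
    heights a and b therefore differ only on the projection, orthogonally to u,
    of the part of B in the strip between the two heights, and since projections
    do not increase length, |f b - f a| is at most the length of that part of B
    ([radon_indic_dist]).  In other words the increments of f are controlled by
    nu, the image of length on B under the projection x |-> <x, u>.  This is a
    finite Borel measure, so if nu is absolutely continuous with respect to
    Lebesgue measure, then f is an absolutely continuous function
    ([absolutely_continuous_radon_indic]).

    It remains to see that nu is absolutely continuous for all but countably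
    many u.  If it is not, some Lebesgue null set E has a preimage A_u in B of
    positive length.  At almost every point of A_u the tangent of B is
    orthogonal to u, so for independent directions u and v the sets A_u and A_v
    are almost disjoint; a set of finite length contains only countably many
    almost disjoint subsets of positive length ([finite_almost_disjoint],
    [countable_singular_directions]).

    Almost disjointness is obtained without differentiating: a Lipschitz curve
    meets a set with two independent null projections in a set of length zero
    ([curve_null]).  The diameter of an arc is comparable to the sum of the
    lengths of its two projections, and the part of the total variation of a
    coordinate spent on values in an open set is small when that open set has
    small measure ([variation_in_small]).

    That nu is a Borel measure follows from the Caratheodory measurability of
    half-planes, by the usual argument for metric outer measures
    ([caratheodory_halfplane]). *)

Set Implicit Arguments.
Unset Strict Implicit.
Unset Printing Implicit Defensive.

Local Open Scope classical_set_scope.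
Local Open Scope ring_scope.

(** * Euclidean plane and diameters *)

Section plane.
Context {R : realType}.
Implicit Types (x y u v : R * R) (A : set (R * R)).

Lemma dot2B x y u : dot2 (x - y) u = dot2 x u - dot2 y u.
Proof. by rewrite /dot2 /=; ring. Qed.

Lemma edist2_ge0 x y : 0 <= edist2 x y.
Proof. exact: sqrtr_ge0. Qed.

Lemma dot2_le_edist2 x y u :
  unit_circle R u -> `|dot2 x u - dot2 y u| <= edist2 x y.
Proof.
rewrite /unit_circle /= -dot2B /edist2 => u1; rewrite -sqrtr_sqr ler_wsqrtr//.
set z := x - y; rewrite -[leRHS]mulr1 -u1.
rewrite -subr_ge0 /dot2.
by rewrite (_ : _ - _ = (z.1 * u.2 - z.2 * u.1) ^+ 2) ?sqr_ge0//; ring.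
Qed.

Definition det2 u v : R := u.1 * v.2 - u.2 * v.1.

(** Cramer's rule recovers a vector from its components along two independent
    unit vectors. *)
Lemma edist2_le_dot2 u v x y :
  unit_circle R u -> unit_circle R v -> det2 u v != 0 ->
  edist2 x y <= `|det2 u v|^-1 *
    (`|dot2 x u - dot2 y u| + `|dot2 x v - dot2 y v|).
Proof.
rewrite /unit_circle /= => u1 v1 d0; rewrite -!dot2B /edist2.
set z := x - y; set a := dot2 z u; set b := dot2 z v.
rewrite -ler_pdivrMl ?invr_gt0 ?normr_gt0// invrK.
have ab0 : 0 <= `|a| + `|b| by rewrite addr_ge0.
rewrite -[leRHS](ger0_norm ab0) -(sqrtr_sqr (det2 u v)) -(sqrtr_sqr (_ + _)).
rewrite -sqrtrM ?sqr_ge0// ler_wsqrtr//.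
have -> : det2 u v ^+ 2 * dot2 z z =
    a ^+ 2 * dot2 v v + b ^+ 2 * dot2 u u - a * b * (2 * dot2 u v).
  by rewrite /a /b /det2 /dot2; ring.
rewrite u1 v1 !mulr1 (sqrrD `|a|) !real_normK ?num_real// -normrM.
have uv : `|dot2 u v| <= 1.
  rewrite -(@expr_le1 _ 2)// -normrX ger0_norm ?sqr_ge0// -[leRHS]mulr1.
  rewrite -[X in X * _]u1 -v1 -subr_ge0 /dot2.
  by rewrite (_ : _ - _ = det2 u v ^+ 2) ?sqr_ge0// /det2; ring.
have : - (a * b * dot2 u v) <= `|a * b|.
  rewrite (le_trans (ler_norm _))// normrN normrM ler_piMr//.
by rewrite mulr2n; lra.
Qed.

Local Open Scope ereal_scope.

Lemma ediam_ge0 A : 0 <= ediam A.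
Proof. by rewrite /ediam le_max lexx. Qed.

Lemma ediam_le A (M : \bar R) : 0 <= M ->
  (forall x y, A x -> A y -> (edist2 x y)%:E <= M) -> ediam A <= M.
Proof.
move=> M0 AM; rewrite /ediam ge_max M0/=; apply: ge_ereal_sup.
by move=> _ [[x y] [Ax Ay] <-]; exact: AM.
Qed.

Lemma edist2_le_ediam A x y : A x -> A y -> (edist2 x y)%:E <= ediam A.
Proof.
move=> Ax Ay; rewrite /ediam le_max; apply/orP; right.
by apply: ereal_sup_ubound; exists (x, y).
Qed.

Lemma ediam_set0 : ediam (@set0 (R * R)) = 0.
Proof. by apply/eqP; rewrite eq_le ediam_ge0 andbT; exact: ediam_le. Qed.

Lemma le_ediam A B : A `<=` B -> ediam A <= ediam B.
Proof.
move=> AB; apply: ediam_le => [|x y /AB Ax /AB Ay]; first exact: ediam_ge0.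
exact: edist2_le_ediam.
Qed.

End plane.

(** * Hausdorff length as an outer measure *)

Section hausdorff1.
Context {R : realType}.
Implicit Types (A B : set (R * R)).
Local Open Scope ereal_scope.

(** Admissibility of a covering set is encoded in its weight, so that the
    content of step d becomes an instance of the usual extension of a set
    function, taken on the sigma-algebra of all sets. *)
Let weight (d : R) (U : set (g_sigma_algebraType [set: set (R * R)])) :=
  if ediam U <= d%:E then ediam U else +oo.

Let weight_ge0 d U : 0 <= weight d U.
Proof. by rewrite /weight; case: ifPn => // _; exact: ediam_ge0. Qed.

Let weight0 d : (0 <= d)%R -> weight d set0 = 0.
Proof. by rewrite /weight ediam_set0 lee_fin => ->. Qed.

Let hausdorff1_deltaE d A : hausdorff1_delta d A = mu_ext (weight d) A.
Proof.
apply/eqP; rewrite eq_le; apply/andP; split.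
  apply: le_ereal_inf_tmp => _ [U [mU AU] <-].
  (* an inadmissible cover has infinite total weight *)
  have [Ud|/existsNP[i /negP iU]] :=
      pselect (forall i, ediam (U i) <= d%:E).
    apply: ereal_inf_lbound; exists U; first by split.
    by apply: eq_eseriesr => i _; rewrite /weight Ud.
  rewrite (eseries_pinfty _ (k := i)) ?leey//.
    by move=> n _; rewrite -ltNye (lt_le_trans _ (weight_ge0 _ _))// ltNyr.
  by rewrite /weight (negbTE iU).
apply: le_ereal_inf_tmp => _ [U [AU Ud] <-].
apply: ereal_inf_lbound; exists U.
  by split=> // i; exact: sub_sigma_algebra.
by apply: eq_eseriesr => i _; rewrite /weight Ud.
Qed.

Lemma hausdorff1_delta_ge0 d A : 0 <= hausdorff1_delta d A.
Proof. by rewrite hausdorff1_deltaE; exact: mu_ext_ge0. Qed.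

Lemma le_hausdorff1_delta d A B : A `<=` B ->
  hausdorff1_delta d A <= hausdorff1_delta d B.
Proof.
by move=> AB; rewrite !hausdorff1_deltaE; exact: (le_mu_ext (weight d) AB).
Qed.

Lemma hausdorff1_delta_sigma_subadditive d : (0 <= d)%R ->
  sigma_subadditive (@hausdorff1_delta R d).
Proof.
move=> d0 F; rewrite hausdorff1_deltaE.
under eq_eseriesr do rewrite hausdorff1_deltaE.
by apply: mu_ext_sigma_subadditive => //; exact: weight0.
Qed.

Lemma hausdorff1_delta0 d : (0 <= d)%R -> hausdorff1_delta d (@set0 (R * R)) = 0.
Proof. by move=> d0; rewrite hausdorff1_deltaE mu_ext0//; exact: weight0. Qed.

Lemma hausdorff1_delta_anti d e A : (d <= e)%R ->
  hausdorff1_delta e A <= hausdorff1_delta d A.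
Proof.
move=> de; apply: ereal_inf_le_tmp => _ [U [AU Ud] <-]; exists U => //.
by split=> // i; rewrite (le_trans (Ud i))// lee_fin.
Qed.

Lemma hausdorff1_delta_le d A : (0 < d)%R -> hausdorff1_delta d A <= hausdorff1 A.
Proof. by move=> d0; apply: ereal_sup_ubound; exists d. Qed.

Lemma hausdorff1_le A (e : R) (M : \bar R) : (0 < e)%R ->
  (forall d, (0 < d)%R -> (d < e)%R -> hausdorff1_delta d A <= M) ->
  hausdorff1 A <= M.
Proof.
move=> e0 AM; apply: ge_ereal_sup => _ [d d0 <-].
have m0 : (0 < Num.min d (e / 2))%R by rewrite lt_min d0 divr_gt0.
rewrite (le_trans (hausdorff1_delta_anti A (_ : Num.min d (e / 2) <= d)%R))//.
  by rewrite ge_min lexx.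
by rewrite AM// gt_min; apply/orP; right; lra.
Qed.

Let hausdorff1_0 : hausdorff1 (@set0 (R * R)) = 0.
Proof.
apply/eqP; rewrite eq_le; apply/andP; split.
  by apply: (hausdorff1_le ltr01) => d d0 _; rewrite hausdorff1_delta0// ltW.
exact: le_trans (hausdorff1_delta_ge0 1 _) (hausdorff1_delta_le _ ltr01).
Qed.

Let hausdorff1_ge0 A : 0 <= hausdorff1 A.
Proof.
exact: le_trans (hausdorff1_delta_ge0 1 _) (hausdorff1_delta_le _ ltr01).
Qed.

Let le_hausdorff1 : {homo @hausdorff1 R : A B / A `<=` B >-> A <= B}.
Proof.
move=> A B AB; apply: (hausdorff1_le ltr01) => d d0 _.
exact: le_trans (le_hausdorff1_delta _ AB) (hausdorff1_delta_le _ d0).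
Qed.

Let hausdorff1_sigma_subadditive : sigma_subadditive (@hausdorff1 R).
Proof.
move=> F; apply: (hausdorff1_le ltr01) => d d0 _.
rewrite (le_trans (hausdorff1_delta_sigma_subadditive (ltW d0) F))//.
apply: lee_nneseries => [i _ _|i _]; first exact: hausdorff1_delta_ge0.
exact: hausdorff1_delta_le.
Qed.

HB.instance Definition _ := isOuterMeasure.Build R (R * R)%type (@hausdorff1 R)
  hausdorff1_0 hausdorff1_ge0 le_hausdorff1 hausdorff1_sigma_subadditive.

End hausdorff1.

Section hausdorff1_on.
Context {R : realType}.
Variable B : set (R * R).
Local Open Scope ereal_scope.

Definition hausdorff1_on (A : set (R * R)) : \bar R := hausdorff1 (A `&` B).

Let hausdorff1_on0 : hausdorff1_on set0 = 0.
Proof. by rewrite /hausdorff1_on set0I outer_measure0. Qed.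

Let hausdorff1_on_ge0 A : 0 <= hausdorff1_on A.
Proof. exact: outer_measure_ge0. Qed.

Let le_hausdorff1_on : {homo hausdorff1_on : A C / A `<=` C >-> A <= C}.
Proof. by move=> A C AC; apply: le_outer_measure; exact: setSI. Qed.

Let hausdorff1_on_sigma_subadditive : sigma_subadditive hausdorff1_on.
Proof.
move=> F; rewrite /hausdorff1_on setI_bigcupl.
exact: outer_measure_sigma_subadditive.
Qed.

HB.instance Definition _ := isOuterMeasure.Build R (R * R)%type hausdorff1_on
  hausdorff1_on0 hausdorff1_on_ge0 le_hausdorff1_on
  hausdorff1_on_sigma_subadditive.

Lemma caratheodory_hausdorff1_on A :
  (@hausdorff1 R).-caratheodory A -> hausdorff1_on.-caratheodory A.
Proof.
by move=> mA X; rewrite /hausdorff1_on [LHS]mA setIAC (setIAC _ B).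
Qed.

End hausdorff1_on.

Section projection.
Context {R : realType}.
Local Notation lambda := (@lebesgue_measure R).
Local Open Scope ereal_scope.

(** Projections do not increase length: a cover of A projects to a cover of W by
    intervals at most as long as the diameters. *)
Lemma lebesgue_le_hausdorff1 (v : R * R) (W : set R) (A : set (R * R)) :
  unit_circle R v -> measurable W ->
  (forall t, W t -> exists2 x, A x & dot2 x v = t) ->
  lambda W <= hausdorff1 A.
Proof.
move=> v1 mW WA; apply: le_trans (hausdorff1_delta_le A ltr01).
apply: le_ereal_inf_tmp => _ [U [AU U1] <-].
have [J HJ] : {J : nat -> set R & forall i, [/\ measurable (J i),
    lambda (J i) <= ediam (U i) & forall x, U i x -> J i (dot2 x v)]}.
  apply: (@choice _ _ (fun i J => [/\ measurable J,
    lambda J <= ediam (U i) & forall x, U i x -> J (dot2 x v)])) => i.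
  have [U0|/set0P[y Uy]] := eqVneq (U i) set0.
    by exists set0; split; rewrite ?U0 ?measure0 ?ediam_ge0.
  have dfin : ediam (U i) \is a fin_num.
    by rewrite ge0_fin_numE ?ediam_ge0// (le_lt_trans (U1 i))// ltry.
  set V := [set dot2 x v | x in U i].
  pose d := fine (ediam (U i)).
  have Vd s t : V s -> V t -> (s <= t + d)%R.
    move=> [x Ux <-] [z Uz <-]; rewrite -lerBlDl.
    rewrite (le_trans (ler_norm _))// (le_trans (dot2_le_edist2 _ _ v1))//.
    by rewrite -lee_fin fineK//; exact: edist2_le_ediam.
  have V0 : V !=set0 by exists (dot2 y v), y.
  have Vy : V (dot2 y v) by exists y.
  have hiV : has_inf V.
    by split=> //; exists (dot2 y v - d)%R => s Vs; rewrite lerBlDr Vd.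
  have hsV : has_sup V by split=> //; exists (dot2 y v + d)%R => s Vs; exact: Vd.
  exists `[inf V, sup V]%classic; split=> //.
    rewrite lebesgue_measure_itv/= lte_fin; case: ltP => _; last exact: ediam_ge0.
    rewrite -EFinB -(fineK dfin) lee_fin lerBlDl; apply: ge_sup => // s Vs.
    rewrite -lerBlDr; apply: lb_le_inf => // t Vt; rewrite lerBlDr; exact: Vd.
  move=> x Ux; rewrite /= in_itv/=; apply/andP; split.
    by apply: ge_inf; [case: hiV|exists x].
  by apply: ub_le_sup; [case: hsV|exists x].
have WJ : W `<=` \bigcup_i J i.
  move=> t /WA[x Ax <-]; have [i _ Uix] := AU x Ax.
  by exists i => //; have [_ _] := HJ i; apply.
have mJ i : measurable (J i) by have [] := HJ i.
apply: (@le_trans _ _ (\sum_(0 <= i <oo) lambda (J i))).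
  exact: (@measure_sigma_subadditive _ _ _ lambda _ _ mJ mW WJ).
by apply: lee_nneseries => [i _ _|i _]; [exact: measure_ge0|have [] := HJ i].
Qed.

End projection.

(** * Half-planes are Caratheodory measurable *)

Section separated.
Context {R : realType}.
Variable u : R * R.
Hypothesis u1 : unit_circle R u.
Implicit Types A C X : set (R * R).
Local Open Scope ereal_scope.

(** A covering set of diameter less than the gap meets only one of the two
    sets, so every fine cover of the union splits into covers of each. *)
Lemma hausdorff1_delta_separated A C (a c d : R) :
  (d < c - a)%R -> (forall x, A x -> dot2 x u <= a)%R ->
  (forall x, C x -> c <= dot2 x u)%R ->
  hausdorff1_delta d A + hausdorff1_delta d C <= hausdorff1_delta d (A `|` C).
Proof.
move=> dac Aa Cc; apply: le_ereal_inf_tmp => _ [U [ACU Ud] <-].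
apply: (@le_trans _ _
    (\sum_(0 <= i <oo) ediam (U i `&` A) + \sum_(0 <= i <oo) ediam (U i `&` C))).
  apply: leeD; apply: ereal_inf_lbound.
  - exists (fun i => U i `&` A) => //; split=> [x Ax|i].
      by have [|i _ Uix] := ACU x; [left|exists i].
    by rewrite (le_trans _ (Ud i))// le_ediam.
  - exists (fun i => U i `&` C) => //; split=> [x Cx|i].
      by have [|i _ Uix] := ACU x; [right|exists i].
    by rewrite (le_trans _ (Ud i))// le_ediam.
rewrite -nneseriesD; do ?by move=> *; exact: ediam_ge0.
apply: lee_nneseries => [i _ _|i _]; first by rewrite adde_ge0 ?ediam_ge0.
have [UA0|/set0P[x [Ux Ax]]] := eqVneq (U i `&` A) set0.
  by rewrite UA0 ediam_set0 add0e le_ediam.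
have [UC0|/set0P[y [Uy Cy]]] := eqVneq (U i `&` C) set0.
  by rewrite UC0 ediam_set0 adde0 le_ediam.
exfalso; have := le_trans (edist2_le_ediam Ux Uy) (Ud i).
rewrite lee_fin leNgt => /negP; apply; rewrite (lt_le_trans dac)//.
rewrite (le_trans _ (dot2_le_edist2 _ _ u1))//.
have := Aa _ Ax; have := Cc _ Cy; rewrite ler_normr; lra.
Qed.

Lemma hausdorff1_separated A C (a c : R) :
  (a < c)%R -> (forall x, A x -> dot2 x u <= a)%R ->
  (forall x, C x -> c <= dot2 x u)%R ->
  hausdorff1 A + hausdorff1 C <= hausdorff1 (A `|` C).
Proof.
move=> ac Aa Cc; have [->|] := eqVneq (hausdorff1 (A `|` C)) +oo.
  by rewrite leey.
rewrite -ltey => fAC.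
have fC : hausdorff1 C \is a fin_num.
  rewrite ge0_fin_numE ?outer_measure_ge0// (le_lt_trans _ fAC)//.
  exact: le_outer_measure.
have fA d : (0 < d)%R -> hausdorff1_delta d A \is a fin_num.
  move=> d0; rewrite ge0_fin_numE ?hausdorff1_delta_ge0//.
  rewrite (le_lt_trans _ fAC)// (le_trans (hausdorff1_delta_le _ d0))//.
  exact: le_outer_measure.
have e0 : (0 < c - a)%R by rewrite subr_gt0.
rewrite -leeBrDr//; apply: (hausdorff1_le e0) => d d0 dac.
rewrite leeBrDr// -leeBrDl ?fA//; apply: (hausdorff1_le d0) => d' d'0 d'd.
rewrite leeBrDl ?fA//.
apply: le_trans (hausdorff1_delta_le _ d'0).
apply: le_trans (hausdorff1_delta_separated (lt_trans d'd dac) Aa Cc).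
by rewrite leeD2r// hausdorff1_delta_anti// ltW.
Qed.

(** Layers accumulating at the edge of the half-plane: non-adjacent layers are
    separated, so their contents are summable, and the part of X close to the
    edge is negligible.  This is the classical argument that metric outer
    measures are Borel. *)
Lemma caratheodory_halfplane (c : R) :
  (@hausdorff1 R).-caratheodory [set x | (dot2 x u < c)%R].
Proof.
apply: le_caratheodory_measurable => X /=.
have [->|] := eqVneq (hausdorff1 X) +oo; first by rewrite leey.
rewrite -ltey => fX.
have fin A : A `<=` X -> hausdorff1 A \is a fin_num.
  move=> AX; rewrite ge0_fin_numE ?outer_measure_ge0//.
  by rewrite (le_lt_trans _ fX)// le_outer_measure.
(* r increases to c; L n is the part of X below level r n and T n is a layer *)
pose r (k : nat) : R := (c - k.+1%:R^-1)%R.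
have r_lt m n : (m < n)%N -> (r m < r n)%R.
  by move=> mn; rewrite /r ltrD2l ltrN2 ltf_pV2 ?posrE// ltr_nat ltnS.
have r_c m : (r m < c)%R by rewrite /r gtrBl invr_gt0.
set A := X `&` _; set C := X `&` _.
pose L n := X `&` [set x | (dot2 x u <= r n)%R].
pose T n := X `&` [set x | (r n.+1 < dot2 x u <= r n.+2)%R].
have LC n : hausdorff1 (L n) + hausdorff1 C <= hausdorff1 X.
  apply: (@le_trans _ _ (hausdorff1 (L n `|` C))).
    apply: (hausdorff1_separated (r_c n)) => [x []//|x [_]] /=.
    by move/negP; rewrite -leNgt.
  by apply: le_outer_measure => x [] [].
(* L n and T n are separated by the strip between levels r n and r n.+1 *)
have LT n : hausdorff1 (L n) + hausdorff1 (T n) <= hausdorff1 (L n.+2).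
  apply: (@le_trans _ _ (hausdorff1 (L n `|` T n))).
    apply: (hausdorff1_separated (r_lt _ _ (ltnSn n))) => [x []//|x].
    by move=> [_ /andP[/ltW]].
  apply: le_outer_measure => x [] [Xx] /=; last by move=> /andP[].
  by move=> xn; split=> //=; rewrite (le_trans xn)// ltW// r_lt.
(* telescoping LT, where every second level is skipped *)
have sumT n : \sum_(0 <= k < n) hausdorff1 (T k) <=
    hausdorff1 (L n) + hausdorff1 (L n.+1).
  elim: n => [|n ih]; first by rewrite big_geq// adde_ge0// outer_measure_ge0.
  rewrite big_nat_recr//= (le_trans (leeD2r _ ih))// addeAC addeC.
  by rewrite leeD2l.
have sumToo : \sum_(0 <= k <oo) hausdorff1 (T k) < +oo.
  apply: (@le_lt_trans _ _ (hausdorff1 X + hausdorff1 X)); last first.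
    exact: lte_add_pinfty.
  apply: lime_le; first by apply: is_cvg_nneseries => *; exact: outer_measure_ge0.
  apply: nearW => n; rewrite (le_trans (sumT n))// leeD// le_outer_measure//;
    exact: subIsetl.
have A_le n : hausdorff1 A + hausdorff1 C <=
    hausdorff1 X + \sum_(n <= k <oo) hausdorff1 (T k).
  apply: (@le_trans _ _ (hausdorff1 (L n.+1) + hausdorff1 C +
      \sum_(n <= k <oo) hausdorff1 (T k))); last by rewrite leeD2r.
  rewrite addeAC leeD2r//.
  apply: le_trans (leeD2l _ (outer_measure_sigma_subadditive_tail _ _ _)).
  apply: le_trans (outer_measureU2 _ _ _); apply: le_outer_measure.
  move=> x [Xx /= xc].
  have [xn|nx] := leP (dot2 x u) (r n.+1); [by left|right].
  (* the first level above x identifies its layer *)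
  have ex : exists m, (dot2 x u <= r m)%R.
    have := ltr_add_invr xc => -[k kc]; exists k.
    by rewrite /r lerBrDr ltW.
  case: (ex_minnP ex) => m xm mmin.
  have nm : (n.+1 < m)%N.
    rewrite ltnNge; apply/negP => mn; have := lt_le_trans nx xm.
    apply/negP; rewrite -leNgt.
    by move: mn; rewrite leq_eqVlt => /predU1P[->//|/r_lt/ltW].
  exists m.-2.
    by rewrite /=; apply/negP; rewrite -leqNgt; case: m nm {xm mmin} => [|[|m]].
  move: m nm xm mmin => [|[|m]]//= nm xm mmin; split=> //=.
  by rewrite xm andbT ltNge; apply/negP => /mmin; rewrite ltnn.
have cvgX : hausdorff1 X + \sum_(n <= k <oo) hausdorff1 (T k) @[n --> \oo]
    --> hausdorff1 X + 0.
  apply: cvgeD; [by rewrite fin_num_adde_defl|exact: cvg_cst|].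
  by apply: nneseries_tail_cvg => // k _; exact: outer_measure_ge0.
rewrite -[leRHS]adde0 -(cvg_lim _ cvgX)//.
apply: lime_ge; first by apply/cvg_ex; eexists; exact: cvgX.
exact: nearW.
Qed.

End separated.

(** * Dyadic variation of a Lipschitz function *)

Section dyadic.
Context {R : realType}.

Lemma exists_half_pow_lt (r : R) (m : nat) : 0 < r ->
  exists n, (m <= n)%N /\ 2 ^- n < r.
Proof.
move=> /ltr_add_invr[k]; rewrite add0r => kr; exists (m + k)%N.
rewrite leq_addr; split=> //; apply: le_lt_trans kr.
rewrite lef_pV2 ?posrE ?exprn_gt0// -natrX ler_nat.
by rewrite (leq_trans (ltn_expl k (ltnSn 1)))// leq_exp2l// leq_addl.
Qed.

Lemma big_nat_double (F : nat -> \bar R) (P : pred nat) n :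
  (\sum_(0 <= k < n.*2 | P k./2) F k =
   \sum_(0 <= k < n | P k) (F k.*2 + F k.*2.+1))%E.
Proof.
elim: n => [|n ih]; first by rewrite !big_geq.
rewrite doubleS !(big_mkcond (fun k => P k./2)) !big_nat_recr//=.
rewrite -!(big_mkcond (fun k => P k./2)) ih.
rewrite [in RHS]big_mkcond big_nat_recr//= -[in RHS]big_mkcond/=.
by rewrite doubleK uphalf_double; case: ifP => _; rewrite ?adde0// addeA.
Qed.

Definition dyadic (n k : nat) : set R :=
  `[k%:R * 2 ^- n, k.+1%:R * 2 ^- n]%classic.

Lemma dyadic00 : dyadic 0 0 = `[0, 1]%classic.
Proof. by rewrite /dyadic expr0 invr1 mul0r mulr1. Qed.

Lemma dyadic_split n k :
  dyadic n k = dyadic n.+1 k.*2 `|` dyadic n.+1 k.*2.+1.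
Proof.
have e m : m.*2%:R * 2 ^- n.+1 = m%:R * 2 ^- n :> R.
  rewrite -muln2 natrM exprS invfM mulrA; congr (_ * _).
  by rewrite -mulrA mulfV// mulr1.
rewrite /dyadic -doubleS !e; set c := (k.*2.+1)%:R * _.
have h : 0 < 2 ^- n.+1 :> R by rewrite invr_gt0 exprn_gt0.
have kc : k%:R * 2 ^- n <= c by rewrite -e ler_pM2r// ler_nat.
have ck : c <= k.+1%:R * 2 ^- n by rewrite -e ler_pM2r// ler_nat doubleS.
apply/seteqP; split=> x /=; rewrite !in_itv/=.
  by move=> /andP[kx xk]; case: (leP x c) => xc; [left|right];
    rewrite ?kx ?xk ?andbT ?(ltW xc).
by move=> [] /andP[a b]; apply/andP; split=> //; lra.
Qed.

Lemma dyadic_half n k : dyadic n.+1 k `<=` dyadic n k./2.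
Proof.
rewrite (dyadic_split n) -{1}(odd_double_half k).
by case: (odd k); [exact: subsetUr|exact: subsetUl].
Qed.

Lemma dyadic_cover n (t : R) : `[0, 1]%classic t ->
  exists2 k, (k < 2 ^ n)%N & dyadic n k t.
Proof.
move=> t01; elim: n => [|n [k kn]]; first by exists 0%N => //; rewrite dyadic00.
rewrite dyadic_split expnS mul2n => -[] kt.
  by exists k.*2 => //; rewrite ltn_double.
by exists k.*2.+1 => //; rewrite ltn_Sdouble.
Qed.

Lemma dyadic_dist n k s t : dyadic n k s -> dyadic n k t ->
  `|s - t| <= 2 ^- n.
Proof.
rewrite /dyadic /= !in_itv/= -[k.+1%:R]natr1 mulrDl mul1r ler_norml.
by move=> /andP[? ?] /andP[? ?]; apply/andP; split; lra.
Qed.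

Lemma dyadic_mem n k : dyadic n k (k%:R * 2 ^- n).
Proof.
rewrite /dyadic /= in_itv/= lexx ler_pM2r ?invr_gt0 ?exprn_gt0//.
by rewrite ler_nat leqnSn.
Qed.

End dyadic.

Section variation.
Context {R : realType}.
Variables (f : R -> R) (M : R).
Hypothesis lipf : forall x y, `|f x - f y| <= M * `|x - y|.
Local Open Scope ereal_scope.
Local Notation lambda := (@lebesgue_measure R).

Lemma lipschitz_fun_continuous : continuous f.
Proof.
have M0 : (0 <= M)%R.
  have := le_trans (normr_ge0 _) (lipf 1 0).
  by rewrite subr0 normr1 mulr1.
have M1 : (0 < M + 1)%R by rewrite ltr_wpDl.
move=> x; apply/cvgrPdist_lt => e e0; near=> y.
rewrite (le_lt_trans (lipf _ _))//.
have : (`|x - y| < e / (M + 1))%R.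
  by near: y; apply: (nbhsx_ballx x); rewrite divr_gt0//.
rewrite ltr_pdivlMr// => h; rewrite (le_lt_trans _ h)// mulrC ler_wpM2l//.
by rewrite lerDl.
Unshelve. all: by end_near. Qed.

Let compact_image n k : compact (f @` dyadic n k).
Proof.
apply: continuous_compact; last exact: segment_compact.
by apply: continuous_subspaceT => x; exact: lipschitz_fun_continuous.
Qed.

Lemma measurable_image_dyadic n k : measurable (f @` dyadic n k).
Proof. exact: measurable_realfun.compact_measurable. Qed.

Lemma dist_le_measure_image n k s t : dyadic n k s -> dyadic n k t ->
  `|f s - f t|%:E <= lambda (f @` dyadic n k).
Proof.
move=> Is It.
wlog st : s t Is It / (s <= t)%R.
  by move=> h; have [/h|/ltW/h] := leP s t; last rewrite distrC; exact.
set a := Num.min (f s) (f t); set b := Num.max (f s) (f t).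
have -> : `|f s - f t|%:E = lambda `[a, b]%classic.
  rewrite lebesgue_measure_itv/= lte_fin /a /b.
  case: (ltgtP (f s) (f t)) => [h|h|->]; last by rewrite ltxx subrr normr0.
  - by rewrite h -EFinB ltr0_norm ?subr_lt0// opprB.
  - by rewrite h -EFinB gtr0_norm ?subr_gt0.
apply: le_measure; rewrite ?inE//; first exact: measurable_image_dyadic.
move=> v /=; rewrite in_itv/= => abv.
have [|c] := IVT st _ abv.
  by apply: continuous_subspaceT => x; exact: lipschitz_fun_continuous.
rewrite in_itv/= => /andP[sc ct] <-; exists c => //.
move: Is It; rewrite /dyadic /= !in_itv/= => /andP[a1 _] /andP[_ b1].
by rewrite (le_trans a1 sc) (le_trans ct b1).
Qed.

Lemma measure_image_dyadic_le n k :
  lambda (f @` dyadic n k) <= (2 * M * 2 ^- n)%:E.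
Proof.
have M0 : (0 <= M)%R.
  have := le_trans (normr_ge0 _) (lipf 1 0).
  by rewrite subr0 normr1 mulr1.
set a := f (k%:R * 2 ^- n)%R; set h := (M * 2 ^- n)%R.
have h0 : (0 <= h)%R by rewrite mulr_ge0// invr_ge0 exprn_ge0.
have -> : (2 * M * 2 ^- n)%:E = lambda `[(a - h)%R, (a + h)%R]%classic.
  rewrite lebesgue_measure_itv/= lte_fin.
  case: ltP => hh; rewrite -?EFinB; congr EFin; rewrite -mulrA -/h; lra.
apply: le_measure; rewrite ?inE//; first exact: measurable_image_dyadic.
move=> _ [t It <-] /=; rewrite in_itv/= -ler_distl.
rewrite (le_trans (lipf _ _))// ler_wpM2l//.
exact: (dyadic_dist It (dyadic_mem n k)).
Qed.

(** This is the integral over O of the number of dyadic intervals of step n on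
    which f takes a given value, a discrete form of the Banach indicatrix. *)
Definition variation_in (O : set R) (n : nat) : \bar R :=
  \sum_(0 <= k < 2 ^ n) lambda (O `&` f @` dyadic n k).

Lemma variation_in_ge0 O n : 0 <= variation_in O n.
Proof. by apply: sume_ge0. Qed.

Lemma variation_in_mono O m n : measurable O -> (m <= n)%N ->
  variation_in O m <= variation_in O n.
Proof.
move=> mO /subnK <-; elim: (n - m)%N => // {}n; rewrite addSn => /le_trans; apply.
move: (n + m)%N => {m}n; rewrite /variation_in expnS mul2n.
rewrite (big_nat_double _ xpredT); apply: lee_sum => k _.
rewrite dyadic_split image_setU setIUr measureU2//;
  by apply: measurableI => //; exact: measurable_image_dyadic.
Qed.

Lemma variation_in_le n : variation_in setT n <= (2 * M)%:E.
Proof.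
rewrite /variation_in.
apply: (@le_trans _ _ (\sum_(0 <= k < 2 ^ n) (2 * M * 2 ^- n)%:E)).
  by apply: lee_sum => k _; rewrite setTI measure_image_dyadic_le.
rewrite sumEFin sumr_const_nat subn0 lee_fin -[leLHS]mulr_natr natrX.
by rewrite mulfVK// expf_neq0.
Qed.

Lemma variation_in_setC O n : measurable O ->
  variation_in setT n = variation_in O n + variation_in (~` O) n.
Proof.
move=> mO; rewrite /variation_in -big_split/=; apply: eq_bigr => k _.
rewrite setTI -measureU//.
- by rewrite -setIUl setUCr setTI.
- by apply: measurableI => //; exact: measurable_image_dyadic.
- by apply: measurableI; [exact: measurableC|exact: measurable_image_dyadic].
- by rewrite setIACA setICr set0I.
Qed.

Lemma variation_in_le_measure O n : measurable O ->
  variation_in O n <= (2 ^+ n)%:E * lambda O.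
Proof.
move=> mO; apply: (@le_trans _ _ (\sum_(0 <= k < 2 ^ n) lambda O)).
  apply: lee_sum => k _; apply: le_measure; rewrite ?inE//.
  by apply: measurableI => //; exact: measurable_image_dyadic.
by rewrite sumr_const_nat subn0 -natrX mule_natl.
Qed.

(** Once a step captures the total variation up to eps / 2, later steps can add
    at most that much over any set, while the indicatrix of that one step is
    bounded. *)
Lemma variation_in_small (eps : R) : (0 < eps)%R ->
  exists2 delta : R, (0 < delta)%R & forall O, measurable O ->
    lambda O < delta%:E -> forall n, variation_in O n <= eps%:E.
Proof.
move=> eps0; have e20 : (0 < eps / 2)%R by rewrite divr_gt0.
have vfin O n : measurable O -> variation_in O n \is a fin_num.
  move=> mO; rewrite ge0_fin_numE ?variation_in_ge0//.
  apply: le_lt_trans (ltry (2 * M)); apply: le_trans (variation_in_le n).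
  by rewrite (variation_in_setC n mO) leeDl// variation_in_ge0.
set S := ereal_sup (range (variation_in setT)).
have Sfin : S \is a fin_num.
  rewrite ge0_fin_numE; last first.
    apply: le_trans (variation_in_ge0 setT 0) _.
    by apply: ereal_sup_ubound; exists 0%N.
  apply: le_lt_trans (ltry (2 * M)); apply: ge_ereal_sup => _ [n _ <-].
  exact: variation_in_le.
have [_ [n0 _ <-] Sn0] := ub_ereal_sup_adherent e20 Sfin.
exists (eps / 2 / 2 ^+ n0)%R; first by rewrite !divr_gt0// exprn_gt0.
move=> O mO Od n.
have n0O : variation_in O n0 <= (eps / 2)%:E.
  rewrite (le_trans (variation_in_le_measure _ mO))//.
  apply: (@le_trans _ _ ((2 ^+ n0)%:E * (eps / 2 / 2 ^+ n0)%:E)).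
    by apply: lee_wpmul2l; rewrite ?lee_fin ?exprn_ge0// ltW.
  by rewrite -EFinM lee_fin mulrC divfK// expf_neq0.
have [nn0|/ltnW n0n] := leqP n n0.
  rewrite (le_trans (variation_in_mono mO nn0))// (le_trans n0O)// lee_fin.
  lra.
have mC : measurable (~` O) by exact: measurableC.
(* the complement of O absorbs its own share of the variation *)
suff : variation_in O n + variation_in (~` O) n <=
    eps%:E + variation_in (~` O) n by rewrite leeD2rE// vfin.
rewrite -variation_in_setC//.
apply: (@le_trans _ _ S); first by apply: ereal_sup_ubound; exists n.
move: Sn0; rewrite -/S lteBlDr// => /ltW/le_trans; apply.
rewrite (variation_in_setC _ mO) addeAC.
apply: leeD; last exact: variation_in_mono.
rewrite [in leRHS](splitr eps) EFinD leeD2r//.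
Qed.

End variation.

(** * Sets with two null projections *)

Lemma null_set_open (R : realType) (E : set R) (d : R) :
  measurable E -> lebesgue_measure E = 0%E -> (0 < d)%R ->
  exists O, [/\ open O, E `<=` O & (lebesgue_measure O < d%:E)%E].
Proof.
move=> mE E0 d0; have Eoo : (lebesgue_measure E < +oo)%E by rewrite E0 ltry.
have [V [oV EV VE]] := lebesgue_regularity_outer mE Eoo d0.
exists V; split=> //; rewrite -(setDUK EV) measureU//.
- by rewrite [X in X + _]E0 add0e.
- by apply: measurableD => //; exact: measurable_realfun.open_measurable.
- exact: setDIK.
Qed.

(** When P is inherited by subintervals, these are the maximal cells satisfying P
    among those of step at least n0; m counts the steps from n0. *)
Definition maximal_cell (n0 : nat) (P : nat -> nat -> bool) (m k : nat) :=
  [&& (k < 2 ^ (n0 + m))%N, P (n0 + m)%N k &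
      (m == 0)%N || ~~ P (n0 + m.-1)%N k./2].

(** At each new step the cells already counted are replaced by their halves,
    which does not decrease their total weight, and the new maximal cells lie
    outside them. *)
Lemma maximal_cell_sum_le (R : realType) (w : nat -> nat -> \bar R)
    (P : nat -> nat -> bool) (n0 m : nat) :
  (forall n k, 0 <= w n k)%E ->
  (forall n k, w n k <= w n.+1 k.*2 + w n.+1 k.*2.+1)%E ->
  (forall n k, P n k./2 -> P n.+1 k) ->
  (\sum_(0 <= j < m.+1) \sum_(0 <= k < 2 ^ (n0 + j) | maximal_cell n0 P j k)
      w (n0 + j)%N k <=
   \sum_(0 <= k < 2 ^ (n0 + m) | P (n0 + m)%N k) w (n0 + m)%N k)%E.
Proof.
move=> w0 ww PP; elim: m => [|m ih].
  rewrite big_nat1 big_mkcond [leRHS]big_mkcond; apply: lee_sum => k _.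
  by rewrite /maximal_cell; case: ifPn => [/and3P[_ ->]//|_]; case: ifP.
rewrite big_nat_recr//=.
set n := (n0 + m)%N; have nE : (n0 + m.+1)%N = n.+1 by rewrite addnS.
rewrite [leRHS](bigID (fun k => P n k./2))/= nE; apply: leeD.
  rewrite (le_trans ih)//= [leRHS](eq_bigl (fun k => P n k./2)); last first.
    by move=> k; apply/andP/idP => [[]//|h]; split=> //; exact: PP.
  rewrite expnS mul2n big_nat_double; exact: lee_sum.
rewrite big_mkcond [leRHS]big_mkcond; apply: lee_sum => k _.
rewrite /maximal_cell nE; case: ifPn => [/and3P[_ -> /= h]|_]; last by case: ifP.
by rewrite -/n in h; rewrite h.
Qed.

Section curve.
Context {R : realType}.
Variables (g : R -> R * R) (u v : R * R) (M : R).
Hypothesis u1 : unit_circle R u.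
Hypothesis v1 : unit_circle R v.
Hypothesis uv : det2 u v != 0.
Let gu t := dot2 (g t) u.
Let gv t := dot2 (g t) v.
Hypothesis lipu : forall s t, `|gu s - gu t| <= M * `|s - t|.
Hypothesis lipv : forall s t, `|gv s - gv t| <= M * `|s - t|.
Local Open Scope ereal_scope.
Local Notation lambda := (@lebesgue_measure R).

Let w n k := lambda (gu @` dyadic n k) + lambda (gv @` dyadic n k).

Let w_ge0 n k : 0 <= w n k.
Proof. exact: adde_ge0. Qed.

Let w_split n k : w n k <= w n.+1 k.*2 + w n.+1 k.*2.+1.
Proof.
rewrite /w addeACA dyadic_split !image_setU; apply: leeD.
- by apply: measureU2; exact: (measurable_image_dyadic lipu).
- by apply: measureU2; exact: (measurable_image_dyadic lipv).
Qed.

Let D := (`|det2 u v|^-1)%R.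

Let D_gt0 : (0 < D)%R. Proof. by rewrite invr_gt0 normr_gt0. Qed.

Let ediam_cell n k : ediam (g @` dyadic n k) <= D%:E * w n k.
Proof.
apply: ediam_le => [|_ _ [s Is <-] [t It <-]].
  by rewrite mule_ge0// lee_fin ltW.
rewrite (@le_trans _ _ (D * (`|gu s - gu t| + `|gv s - gv t|))%:E)//.
  by rewrite lee_fin edist2_le_dot2.
rewrite EFinM EFinD lee_wpmul2l ?lee_fin ?(ltW D_gt0)//.
by apply: leeD; [exact: (dist_le_measure_image lipu)|
  exact: (dist_le_measure_image lipv)].
Qed.

Let w_le n k : w n k <= (4 * M * 2 ^- n)%:E.
Proof.
rewrite (_ : (4 * M * 2 ^- n)%R = (2 * M * 2 ^- n + 2 * M * 2 ^- n)%R).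
  rewrite EFinD; apply: leeD; [exact: (measure_image_dyadic_le lipu)|
    exact: (measure_image_dyadic_le lipv)].
by rewrite -!mulrDl; congr (_ * _ * _)%R; lra.
Qed.

(** The maximal cells that the two coordinates map into O and O' cover the set,
    the diameter of a cell is bounded by the lengths of its projections, and
    these add up to at most the variations over O and O'. *)
Let curve_delta_small (O O' : set R) (d eps : R) :
  open O -> open O' -> (0 < d)%R ->
  (forall n, variation_in gu O n <= eps%:E) ->
  (forall n, variation_in gv O' n <= eps%:E) ->
  hausdorff1_delta d (g @` (`[0%R, 1%R] `&` gu @^-1` O `&` gv @^-1` O')) <=
  (D * (eps + eps))%:E.
Proof.
move=> oO oO' d0 Oe O'e.
have M0 : (0 <= M)%R.
  have := le_trans (normr_ge0 _) (lipu 1 0).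
  by rewrite subr0 normr1 mulr1.
(* from step n0 on, the images of cells have diameter at most d *)
have [n0 [_ n0d]] : exists n, (0 <= n)%N /\ (2 ^- n < d / (D * 4 * M + 1))%R.
  by apply: exists_half_pow_lt; rewrite divr_gt0// ltr_wpDl// !mulr_ge0// ltW.
have small n k : (n0 <= n)%N -> ediam (g @` dyadic n k) <= d%:E.
  move=> n0n; rewrite (le_trans (ediam_cell n k))//.
  apply: (@le_trans _ _ (D%:E * (4 * M * 2 ^- n)%:E)).
    by rewrite lee_wpmul2l ?lee_fin ?(ltW D_gt0).
  rewrite -EFinM lee_fin.
  have h : (2 ^- n <= 2 ^- n0 :> R)%R.
    by rewrite lef_pV2 ?posrE ?exprn_gt0// ler_eXn2l ?ltr1n.
  have := le_lt_trans h n0d.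
  rewrite ltr_pdivlMr; last by rewrite ltr_wpDl// !mulr_ge0// ltW.
  rewrite mulrDr mulr1 => {}h; rewrite !mulrA mulrC.
  by rewrite ltW// (le_lt_trans _ h)// lerDl invr_ge0 exprn_ge0.
pose P n k := `[< dyadic n k `<=` gu @^-1` O `&` gv @^-1` O' >].
have PP n k : P n k./2 -> P n.+1 k.
  by move=> /asboolP h; apply/asboolP; exact: (subset_trans (@dyadic_half _ n k) h).
pose F m k := if maximal_cell n0 P m k then g @` dyadic (n0 + m) k else set0.
apply: (@le_trans _ _ (hausdorff1_delta d (\bigcup_m \bigcup_k F m k))).
  apply: le_hausdorff1_delta => _ [t [[t01 Ot] O't] <-].
  (* the first step with an admissible cell around t gives a maximal one *)
  have ex : exists m,
      [exists k : 'I_(2 ^ (n0 + m)), (t \in dyadic (n0 + m) k) && P (n0 + m)%N k].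
    have [e /= e0 te] : nbhs t (gu @^-1` O `&` gv @^-1` O').
      by apply: filterI; [apply: (lipschitz_fun_continuous lipu)|
        apply: (lipschitz_fun_continuous lipv)]; exact: open_nbhs_nbhs.
    have [n [n0n ne]] := exists_half_pow_lt n0 e0.
    have [k kn tk] := dyadic_cover n t01.
    exists (n - n0)%N; rewrite subnKC//; apply/existsP; exists (Ordinal kn) => /=.
    apply/andP; split; [exact: mem_set|apply/asboolP => s sk; apply: te => /=].
    exact: le_lt_trans (dyadic_dist tk sk) ne.
  case: (ex_minnP ex) => m /existsP[[k km] /= /andP[/set_mem tk Pk]] mmin.
  exists m => //; exists k => //; rewrite /F ifT; first by exists t.
  rewrite /maximal_cell km Pk/=; case: m => [|m]//= in km tk Pk mmin *.
  apply/negP => Pk2; have := mmin m; rewrite ltnn => h; apply: notF; apply: h.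
  have k2 : (k./2 < 2 ^ (n0 + m))%N.
    by rewrite ltn_half_double -mul2n -expnS -addnS.
  apply/existsP; exists (Ordinal k2) => /=; rewrite Pk2 andbT.
  by apply: mem_set; apply: dyadic_half; rewrite -addnS.
have Fd m k : hausdorff1_delta d (F m k) <= ediam (F m k).
  have Fs : ediam (F m k) <= d%:E.
    rewrite /F; case: ifP => _; first by rewrite small// leq_addr.
    by rewrite ediam_set0 lee_fin ltW.
  apply: ereal_inf_lbound; exists (fun i => if i is 0%N then F m k else set0).
    split=> [x Fx|[|i]//]; first by exists 0%N.
    by rewrite ediam_set0 lee_fin ltW.
  rewrite nneseries_recl//; last by move=> *; exact: ediam_ge0.
  rewrite eseries_cond/= eseries0 ?adde0// => -[|i]//= _ _.
  by rewrite ediam_set0.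
rewrite (le_trans (hausdorff1_delta_sigma_subadditive (ltW d0) _))//.
apply: (@le_trans _ _ (\sum_(0 <= m <oo)
    D%:E * \sum_(0 <= k < 2 ^ (n0 + m) | maximal_cell n0 P m k) w (n0 + m)%N k)).
  apply: lee_nneseries => [m _ _|m _]; first exact: hausdorff1_delta_ge0.
  rewrite (le_trans (hausdorff1_delta_sigma_subadditive (ltW d0) _))//.
  rewrite (nneseries_split 0 (2 ^ (n0 + m))); last first.
    by move=> *; exact: hausdorff1_delta_ge0.
  rewrite add0n eseries0 ?adde0; last first.
    move=> k km _; rewrite /F /maximal_cell ltnNge km/=.
    by rewrite hausdorff1_delta0// ltW.
  rewrite ge0_sume_distrr// [leRHS]big_mkcond/=; apply: lee_sum => k _.
  rewrite (le_trans (Fd _ _))// /F; case: ifP => _; first exact: ediam_cell.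
  by rewrite ediam_set0.
apply: lime_le.
  by apply: is_cvg_nneseries => *; rewrite mule_ge0 ?sume_ge0// lee_fin ltW.
apply: nearW => -[|m].
  rewrite big_geq// lee_fin mulr_ge0// ?(ltW D_gt0)//.
  have e0 : (0 <= eps)%R.
    by rewrite -lee_fin (le_trans _ (Oe 0%N))// variation_in_ge0.
  by rewrite addr_ge0.
rewrite -ge0_sume_distrr; last by move=> *; exact: sume_ge0.
rewrite EFinM lee_wpmul2l ?lee_fin ?(ltW D_gt0)//.
rewrite (le_trans (maximal_cell_sum_le _ _ w_ge0 w_split PP))//.
rewrite /w big_split/= EFinD; apply: leeD.
- rewrite (le_trans _ (Oe (n0 + m)%N))// /variation_in big_mkcond/=.
  apply: lee_sum => k _; case: ifPn => // /asboolP h.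
  by rewrite setIidr// => _ [t /h[? _] <-].
- rewrite (le_trans _ (O'e (n0 + m)%N))// /variation_in big_mkcond/=.
  apply: lee_sum => k _; case: ifPn => // /asboolP h.
  by rewrite setIidr// => _ [t /h[_ ?] <-].
Qed.

(** Regularity of Lebesgue measure encloses the two null sets in open sets of
    small measure. *)
Lemma curve_null (E E' : set R) :
  measurable E -> measurable E' -> lambda E = 0 -> lambda E' = 0 ->
  hausdorff1 (g @` `[0%R, 1%R] `&` [set x | E (dot2 x u)] `&`
    [set x | E' (dot2 x v)]) = 0.
Proof.
move=> mE mE' E0 E'0; apply/eqP; rewrite eq_le outer_measure_ge0 andbT.
apply: (hausdorff1_le ltr01) => d d0 _; apply/lee_addgt0Pr => e e0.
rewrite add0e; pose eps := (e / (D + D))%R.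
have eps0 : (0 < eps)%R by rewrite divr_gt0// addr_gt0.
have [d1 d1_gt0 hu] := variation_in_small lipu eps0.
have [d2 d2_gt0 hv] := variation_in_small lipv eps0.
have [V [oV EV Vd]] := null_set_open mE E0 d1_gt0.
have [V' [oV' EV' V'd]] := null_set_open mE' E'0 d2_gt0.
have -> : e = (D * (eps + eps))%R.
  rewrite /eps; move: D D_gt0 => c c0; field.
  by rewrite ?andbT lt0r_neq0// addr_gt0.
have mV := measurable_realfun.open_measurable oV.
have mV' := measurable_realfun.open_measurable oV'.
apply: le_trans (curve_delta_small oV oV' d0 (hu _ mV Vd) (hv _ mV' V'd)).
apply: le_hausdorff1_delta => _ [[[t t01 <-] /= Et] E't].
by exists t => //; split; [split=> //|]; [exact: EV|exact: EV'].
Qed.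

End curve.

Section rectifiable_null.
Context {R : realType}.
Implicit Types (u v : R * R) (C : set (R * R)) (E : set R).
Local Notation lambda := (@lebesgue_measure R).

Lemma unit_circle_le1 u : unit_circle R u -> `|u.1| <= 1 /\ `|u.2| <= 1.
Proof.
rewrite /unit_circle /dot2 /= => u1.
have h1 := sqr_ge0 u.1; have h2 := sqr_ge0 u.2; rewrite !expr2 in h1 h2.
by split; rewrite -(@expr_le1 _ 2)// real_normK ?num_real// expr2; lra.
Qed.

(** Composing with the retraction of the line onto [0, 1] makes the coordinates
    of the parametrization Lipschitz on the whole line. *)
Lemma lipschitz_curve_extend C : lipschitz_curve C ->
  exists (g : R -> R * R) (M : R), C = g @` `[0, 1] /\
    forall u, unit_circle R u ->
      forall s t, `|dot2 (g s) u - dot2 (g t) u| <= M * `|s - t|.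
Proof.
move=> [g /pinfty_ex_gt0[M M0 gM] ->].
pose c (t : R) := Num.max 0 (Num.min 1 t).
have c01 t : `[0, 1]%classic (c t).
  by rewrite /c /= in_itv/= le_max lexx/= ge_max ler01 ge_min lexx.
have cid t : `[0, 1]%classic t -> c t = t.
  by rewrite /c /= in_itv/= => /andP[t0 t1]; rewrite min_r// max_r.
have cc s t : `|c s - c t| <= `|s - t|.
  have := ler_norm (s - t); have := ler_norm (t - s); rewrite (distrC t).
  rewrite ler_norml /c => ts st; apply/andP.
  by case: (leP 1 s) => s1; case: (leP 1 t) => t1;
    case: (leP 0 s) => s0; case: (leP 0 t) => t0; rewrite ?(max_r ler01); split; lra.
exists (g \o c), (2 * M); split.
  apply/seteqP; split=> _ [t t01 <-]; exists t => //=; first by rewrite cid.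
  by rewrite cid.
move=> u /unit_circle_le1[u1 u2] s t /=; rewrite -dot2B.
have := gM (c s, c t) (conj (c01 s) (c01 t)); rewrite /self_sub/= prod_normE.
set z := g (c s) - g (c t) => gz.
have [z1 z2] : `|z.1| <= M * `|s - t| /\ `|z.2| <= M * `|s - t|.
  have Mst : M * `|c s - c t| <= M * `|s - t| by rewrite ler_wpM2l// ltW.
  by move: (le_trans gz Mst); rewrite ge_max => /andP[].
have le1 (a b : R) : `|b| <= 1 -> `|a * b| <= `|a|.
  by move=> b1; rewrite normrM ler_piMr.
rewrite /dot2 (le_trans (ler_normD _ _))//.
rewrite -mulrA mulr_natl mulr2n.
by apply: lerD; [exact: le_trans (le1 _ _ u1) z1|exact: le_trans (le1 _ _ u2) z2].
Qed.


Lemma rectifiable_null (B : set (R * R)) u v E E' :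
  rectifiable B -> unit_circle R u -> unit_circle R v -> det2 u v != 0 ->
  measurable E -> measurable E' -> lambda E = 0%E -> lambda E' = 0%E ->
  hausdorff1 ([set x | E (dot2 x u)] `&` [set x | E' (dot2 x v)] `&` B) = 0%E.
Proof.
move=> [C [N [lipC N0 BCN]]] u1 v1 uv mE mE' E0 E'0.
set A := _ `&` [set x | E' _].
have CA0 i : hausdorff1 (C i `&` A) = 0%E.
  have [g [M [-> gM]]] := lipschitz_curve_extend (lipC i).
  by rewrite /A setIA (curve_null u1 v1 uv (gM u u1) (gM v v1)).
apply/eqP; rewrite eq_le outer_measure_ge0 andbT.
apply: (@le_trans _ _ (hausdorff1 ((\bigcup_i (C i `&` A)) `|` N))).
  apply: le_outer_measure => x [Ax /BCN[[i _ Cx]|Nx]]; last by right.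
  by left; exists i.
apply: le_trans (outer_measureU2 _ _ _) _; rewrite /= N0 adde0.
apply: le_trans (outer_measure_sigma_subadditive _ _) _.
by rewrite eseries0// => i _ _; exact: CA0.
Qed.

End rectifiable_null.

(** * Directions in which length projects singularly *)

Section projections.
Context {R : realType}.
Variable B : set (R * R).
Hypothesis fB : (hausdorff1 B < +oo)%E.
Implicit Types (u v : R * R) (E : set R).
Local Notation lambda := (@lebesgue_measure R).
Local Notation mu := (hausdorff1_on B).
Local Open Scope ereal_scope.

Lemma hausdorff1_on_lty A : mu A < +oo.
Proof. by apply: le_lt_trans fB; apply: le_outer_measure; exact: subIsetr. Qed.

Lemma measurable_dot2 u : unit_circle R u ->
  measurable_fun [set: caratheodory_type mu] (fun x : R * R => dot2 x u).
Proof.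
move=> u1; apply: (measurability _ (measurable_realfun.RGenInftyO.measurableE R)).
move=> _ [_ [c ->] <-]; rewrite setTI preimage_itvNyo.
exact/caratheodory_hausdorff1_on/caratheodory_halfplane.
Qed.

Lemma caratheodory_preimage_dot2 u E : unit_circle R u -> measurable E ->
  mu.-caratheodory [set x | E (dot2 x u)].
Proof.
move=> u1 mE; have := measurable_dot2 u1 measurableT mE.
by rewrite setTI.
Qed.

Lemma projected_measure u : unit_circle R u ->
  exists nu : {finite_measure set (measurableTypeR R) -> \bar R},
    forall E, nu E = mu [set x | E (dot2 x u)].
Proof.
move=> u1.
pose f (E : set (measurableTypeR R)) := mu [set x | E (dot2 x u)].
have f0 : f set0 = 0 by exact: outer_measure0.
have f_ge0 E : 0 <= f E by exact: outer_measure_ge0.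
have fs : semi_sigma_additive f.
  move=> F mF tF mUF; apply: caratheodory_measure_sigma_additive.
  - by move=> i; exact: (caratheodory_preimage_dot2 u1 (mF i)).
  - apply/trivIsetP => i j _ _ ij; apply/seteqP; split=> // x [Fi Fj].
    by move/trivIsetP : tF => /(_ i j I I ij)/seteqP[+ _] => /(_ (dot2 x u)); exact.
  - exact: (caratheodory_preimage_dot2 u1 mUF).
pose mx := isMeasure.Build _ _ _ f f0 f_ge0 fs.
have [m mE] : exists m : {measure set (measurableTypeR R) -> \bar R}, m =1 f.
  by pose m : {measure set (measurableTypeR R) -> \bar R} := HB.pack f mx; exists m.
have ff : fin_num_fun m.
  by move=> E _; rewrite ge0_fin_numE ?measure_ge0// mE; exact: hausdorff1_on_lty.
have sf : sigma_finite setT m.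
  by apply: fin_num_fun_sigma_finite => //; rewrite measure0.
pose fx := isFinite.Build _ _ _ _ ff.
pose sfx := isSFinite.Build _ _ _ _ (sfinite_measure_sigma_finite sf).
pose sigfx := isSigmaFinite.Build _ _ _ _ sf.
pose nu : {finite_measure set (measurableTypeR R) -> \bar R} :=
  HB.pack (Measure.sort m) fx sfx sigfx.
by exists nu.
Qed.

End projections.

Section singular_directions.
Context {R : realType}.
Implicit Types (u v : R * R) (E : set R) (B : set (R * R)).
Local Notation lambda := (@lebesgue_measure R).
Local Open Scope ereal_scope.

(** These are the directions u for which the image of length on B under the
    projection x |-> dot2 x u is not absolutely continuous with respect to
    Lebesgue measure. *)
Definition singular_direction B u := exists E : set R,
  [/\ measurable E, lambda E = 0 & 0 < hausdorff1_on B [set x | E (dot2 x u)]].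

(** For a finite measure, the limsup of infinitely many sets of measure at least
    r has measure at least r, whereas the limsup of almost disjoint sets is
    null. *)
Lemma finite_almost_disjoint (T J : pointedType)
    (mu : {outer_measure set T -> \bar R}) (F : J -> set T) (S : set J)
    (r : R) :
  mu setT < +oo -> (0 < r)%R ->
  (forall i, S i -> mu.-caratheodory (F i)) ->
  (forall i, S i -> r%:E <= mu (F i)) ->
  (forall i j, S i -> S j -> i != j -> mu (F i `&` F j) = 0) ->
  finite_set S.
Proof.
move=> muT r0 mF rF FF0; apply: contrapT.
move=> /infiniteP/pcard_leP/injfunPex[/= q q_fun q_inj].
have Sq k : S (q k) by exact: q_fun.
pose G k : set (caratheodory_type mu) := F (q k).
have mG k : measurable (G k) by exact: mF.
have G0 : mu (lim_sup_set G) = 0.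
  apply/eqP; rewrite eq_le outer_measure_ge0 andbT.
  apply: (@le_trans _ _ (mu (\bigcup_j \bigcup_k (G j `&` G (j + k.+1)%N)))).
    apply: le_outer_measure => x Gx.
    have [j _ Gjx] := Gx 0%N I.
    have [k /= jk Gkx] := Gx j.+1 I.
    by exists j => //; exists (k - j.+1)%N => //; rewrite addnS -addSn subnKC.
  rewrite (le_trans (outer_measure_sigma_subadditive mu _))//.
  rewrite eseries0// => j _ _; apply/eqP; rewrite eq_le outer_measure_ge0 andbT.
  rewrite (le_trans (outer_measure_sigma_subadditive mu _))//.
  rewrite eseries0// => k _ _; apply: FF0 => //.
  apply/negP => /eqP/q_inj; rewrite !inE => /(_ I I)/eqP.
  by rewrite -{1}(addn0 j) eqn_add2l.
have Goo : mu (\bigcup_(k in [set k | (0 <= k)%N]) G k) < +oo.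
  exact: le_lt_trans (le_outer_measure mu _ _ (@subsetT _ _)) muT.
have cG := lim_sup_set_cvg mu G mG Goo.
suff : r%:E <= mu (lim_sup_set G) by rewrite G0 lee_fin leNgt r0.
rewrite -(cvg_lim _ cG)//; apply: lime_ge; first by apply/cvg_ex; eexists; exact: cG.
apply: nearW => n; rewrite (le_trans (rF _ (Sq n)))//.
by apply: le_outer_measure => x Gx; exists n => /=.
Qed.

(** Each singular direction is charged with the part of B above a Lebesgue null
    set; for independent directions these parts meet in a set with two null
    projections. *)
Lemma countable_singular_directions B (S : set (R * R)) :
  hausdorff1 B < +oo -> rectifiable B -> S `<=` unit_circle R ->
  (forall u v, S u -> S v -> u != v -> det2 u v != 0%R) ->
  countable (S `&` [set u | singular_direction B u]).
Proof.
move=> fB rB S1 Sdet.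
have [E HE] : {E : R * R -> set R & forall u, singular_direction B u ->
    [/\ measurable (E u), lambda (E u) = 0 &
        0 < hausdorff1_on B [set x | E u (dot2 x u)]]}.
  apply: (@choice _ _ (fun u E => singular_direction B u ->
    [/\ measurable E, lambda E = 0 &
        0 < hausdorff1_on B [set x | E (dot2 x u)]])) => u.
  have [[E HE]|nsu] := pselect (singular_direction B u); first by exists E.
  by exists set0.
pose F u := [set x | E u (dot2 x u)].
pose Sn (n : nat) := [set u | [/\ S u, singular_direction B u &
  (n.+1%:R^-1)%:E <= hausdorff1_on B (F u)]].
apply: (@sub_countable _ _ _ (\bigcup_n Sn n)).
  apply: subset_card_le => u [Su su]; have [_ _ F0] := HE u su.
  have fF : hausdorff1_on B (F u) \is a fin_num.
    by rewrite ge0_fin_numE ?outer_measure_ge0//; exact: hausdorff1_on_lty.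
  move: F0; rewrite -/(F u) -(fineK fF) lte_fin => /ltr_add_invr[k].
  by rewrite add0r => kF; exists k => //; split=> //; rewrite -(fineK fF) lee_fin ltW.
apply: bigcup_countable => // n _; apply: finite_set_countable.
apply: (@finite_almost_disjoint _ _ (hausdorff1_on B) F _ n.+1%:R^-1).
- exact: hausdorff1_on_lty.
- by [].
- move=> u [Su su _]; have [mE _ _] := HE u su.
  by apply: caratheodory_preimage_dot2 => //; exact: S1.
- by move=> u [].
- move=> u v [Su su _] [Sv sv _] uv.
  have [mEu Eu0 _] := HE u su; have [mEv Ev0 _] := HE v sv.
  by apply: rectifiable_null => //; [exact: S1|exact: S1|exact: Sdet].
Qed.

Lemma det2_eq0 u v : unit_circle R u -> unit_circle R v -> det2 u v = 0%R ->
  u = v \/ u = (- v)%R.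
Proof.
rewrite /unit_circle /= => u1 v1 d0; set c := dot2 u v.
have uE : u = (c * v.1, c * v.2)%R.
  rewrite [LHS]surjective_pairing; congr pair.
  - transitivity (u.1 * dot2 v v)%R; first by rewrite v1 mulr1.
    transitivity (c * v.1 + det2 u v * v.2)%R; last by rewrite d0 mul0r addr0.
    by rewrite /c /det2 /dot2; ring.
  - transitivity (u.2 * dot2 v v)%R; first by rewrite v1 mulr1.
    transitivity (c * v.2 - det2 u v * v.1)%R; last by rewrite d0 mul0r subr0.
    by rewrite /c /det2 /dot2; ring.
have : (c ^+ 2 = 1)%R.
  rewrite -[RHS]u1 -[LHS]mulr1 -v1 uE /dot2 /=; ring.
move=> /eqP; rewrite sqrf_eq1 => /orP[]/eqP cE; [left|right]; rewrite uE cE.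
- by rewrite !mul1r -surjective_pairing.
- by rewrite !mulN1r.
Qed.

(** Opposite directions are the only dependent pairs on the circle, so each of
    two complementary half-open half-circles is pairwise independent. *)
Lemma countable_singular_circle B : hausdorff1 B < +oo -> rectifiable B ->
  countable (unit_circle R `&` [set u | singular_direction B u]).
Proof.
move=> fB rB.
pose up (u : R * R) := (0 < u.2)%R || ((u.2 == 0%R) && (0 < u.1)%R).
have upN u : unit_circle R u -> up (- u)%R = ~~ up u.
  rewrite /unit_circle /dot2 /up /= oppr_gt0 oppr_eq0 oppr_gt0 => u1.
  case: ltgtP => //= u20; rewrite ?u20 ?ltxx//= -leNgt.
  rewrite lt_neqAle andb_idl// => _; apply/eqP => u10.
  by move: u1; rewrite u10 u20 !mul0r addr0 => /eqP; rewrite eq_sym oner_eq0.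
have half (b : bool) : countable ((unit_circle R `&` [set u | up u = b]) `&`
    [set u | singular_direction B u]).
  apply: countable_singular_directions => // u v [u1 ub] [v1 vb] uv.
  apply/eqP => /(det2_eq0 u1 v1)[/eqP|uE]; first by rewrite (negbTE uv).
  by move: ub; rewrite uE /= upN// vb; case: b {vb}.
apply: (@sub_countable _ _ _ (\bigcup_(b in [set: bool])
    ((unit_circle R `&` [set u | up u = b]) `&`
     [set u | singular_direction B u]))).
  by apply: subset_card_le => u [u1 su]; exists (up u).
by apply: bigcup_countable => // b _; exact: half.
Qed.

End singular_directions.

(** * Slices of a compact set *)

(** Otherwise the part of the segment inside K would be both open and closed in
    it, contradicting connectedness. *)
Lemma segment_meets_boundary (R : realType) (T : topologicalType)
    (phi : R -> T) (K : set T) (a b : R) :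
  continuous phi -> closed K -> a <= b -> K (phi a) <> K (phi b) ->
  exists2 s, a <= s <= b & boundary K (phi s).
Proof.
move=> cphi cK ab Kab; apply: contrapT => nB.
have Ko s : a <= s <= b -> K (phi s) -> K° (phi s).
  move=> sab Ks; apply: contrapT => nKs; apply: nB; exists s => //.
  by split=> //; exact: subset_closure.
have aab : `[a, b]%classic a by rewrite /= in_itv/= lexx.
have bab : `[a, b]%classic b by rewrite /= in_itv/= lexx ab.
pose P := `[a, b] `&` phi @^-1` K.
have PE : P !=set0 -> P = `[a, b]%classic.
  move=> P0; apply: (@segment_connected R a b P P0).
    exists (phi @^-1` K°).
      by apply: open_comp; [move=> x _; exact: cphi|exact: open_interior].
    apply/seteqP; split=> s [sab Ks]; split=> //.
      by apply: Ko Ks; move: sab; rewrite /= in_itv.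
    exact: interior_subset Ks.
  by exists (phi @^-1` K) => //; apply: closed_comp => // x _; exact: cphi.
apply: Kab; apply/propext; split=> [Ka|Kb].
- by have [] : P b by rewrite (PE (ex_intro _ a (conj aab Ka))).
- by have [] : P a by rewrite (PE (ex_intro _ b (conj bab Kb))).
Qed.

Section slices.
Context {R : realType}.
Variable u : R * R.
Hypothesis u1 : unit_circle R u.
Local Notation lambda := (@lebesgue_measure R).

Let continuous_affine (c k : R) :
  continuous (fun t : R => c + t * k) /\ continuous (fun t : R => c - t * k).
Proof.
by split=> t; [apply: cvgD|apply: cvgB];
  do ?[exact: cvg_cst|apply: cvgM; [exact: cvg_id|exact: cvg_cst]].
Qed.

Lemma continuous_line_param_l (t : R) : continuous (line_param u ^~ t).
Proof.
move=> r; rewrite /line_param.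
under eq_fun do rewrite (addrC (_ * u.1)) (addrC (_ * u.2)).
rewrite (addrC (_ * u.1)) (addrC (_ * u.2)).
exact: (cvg_pair ((continuous_affine _ _).1 r) ((continuous_affine _ _).1 r)).
Qed.

Lemma continuous_line_param_r (r : R) : continuous (line_param u r).
Proof.
move=> t.
exact: (cvg_pair ((continuous_affine _ _).2 t) ((continuous_affine _ _).1 t)).
Qed.

Let normal : R * R := (- u.2, u.1).

Lemma unit_circle_normal : unit_circle R normal.
Proof.
by rewrite /unit_circle /normal /dot2 /= mulrNN addrC; exact: u1.
Qed.

Lemma dot2_line_param r t : dot2 (line_param u r t) u = r.
Proof.
rewrite /dot2 /=; transitivity (r * dot2 u u); last by rewrite u1 mulr1.
by rewrite /dot2; ring.
Qed.

Lemma dot2_line_param_normal r t : dot2 (line_param u r t) normal = t.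
Proof.
rewrite /dot2 /=; transitivity (t * dot2 u u); last by rewrite u1 mulr1.
by rewrite /dot2; ring.
Qed.

Local Open Scope ereal_scope.

Variable K : set (R * R).
Hypothesis cK : compact K.

Let closedK : closed K.
Proof. by apply: compact_closed => //; exact: norm_hausdorff. Qed.

Let slice (r : R) := [set t | K (line_param u r t)].

Let radon_indicE r : radon_indic u K r = fine (lambda (slice r)).
Proof.
rewrite /radon_indic /line_measure; congr (fine (lambda _)).
apply/seteqP; split=> t /=; first by case.
by move=> Kt; split=> //; exact: dot2_line_param.
Qed.

Let measurable_slice r : measurable (slice r).
Proof.
apply: measurable_realfun.closed_measurable; apply: (closed_comp _ closedK).
by move=> t _; exact: continuous_line_param_r.
Qed.

Let slice_fin r : lambda (slice r) \is a fin_num.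
Proof.
rewrite ge0_fin_numE//.
have ck : compact ((fun x : R * R => dot2 x normal) @` K).
  apply: continuous_compact => //; apply: continuous_subspaceT => x.
  by apply: cvgD; apply: cvgM;
    do ?[exact: cvg_fst|exact: cvg_snd|exact: cvg_cst].
apply: le_lt_trans (compact_finite_measure ck).
apply: le_measure; rewrite ?inE.
- exact: measurable_slice.
- exact: measurable_realfun.compact_measurable.
by move=> t Kt; exists (line_param u r t) => //; exact: dot2_line_param_normal.
Qed.

(** Where two parallel slices differ, the segment joining them crosses the
    boundary of K. *)
Lemma radon_indic_dist (a b : R) : (a <= b)%R ->
  `|radon_indic u K b - radon_indic u K a|%:E <=
  hausdorff1_on (boundary K) [set x | `[a, b]%classic (dot2 x u)].
Proof.
move=> ab; rewrite !radon_indicE.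
set X := slice b; set Y := slice a.
have mX : measurable X by exact: measurable_slice.
have mY : measurable Y by exact: measurable_slice.
set W := (X `\` Y) `|` (Y `\` X).
have mW : measurable W by apply: measurableU; exact: measurableD.
have XY (A C : set R) : measurable A -> measurable C ->
    lambda A \is a fin_num -> lambda C \is a fin_num ->
    A `\` C `<=` W -> ((fine (lambda A) - fine (lambda C))%:E <= lambda W).
  move=> mA mC fA fC ACW; rewrite EFinB !fineK// leeBlDr//.
  apply: (@le_trans _ _ (lambda ((A `\` C) `|` C))).
    apply: le_measure; rewrite ?inE//.
      by apply: measurableU => //; exact: measurableD.
    by move=> t At; have [Ct|nCt] := pselect (C t); [right|left].
  rewrite (le_trans (measureU2 _ _ _))//; first exact: measurableD.
  rewrite leeD2r//; apply: le_measure; rewrite ?inE//; exact: measurableD.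
apply: (@le_trans _ _ (lambda W)).
  have [h|h] := leP (fine (lambda Y)) (fine (lambda X)).
    by rewrite ger0_norm ?subr_ge0//; apply: XY => //;
      [exact: slice_fin|exact: slice_fin|move=> t; left].
  by rewrite ltr0_norm ?subr_lt0// opprB; apply: XY => //;
      [exact: slice_fin|exact: slice_fin|move=> t; right].
apply: (@lebesgue_le_hausdorff1 _ normal) => //; first exact: unit_circle_normal.
move=> t Wt.
have [|s sab Bs] := @segment_meets_boundary R _ (line_param u ^~ t) K a b
    (@continuous_line_param_l t) closedK ab.
  move=> Kab; move: Wt; rewrite /W /X /Y /slice /=.
  by move: Kab => /= ->; case=> [] [].
exists (line_param u s t); last exact: dot2_line_param_normal.
by split=> //=; rewrite dot2_line_param in_itv.
Qed.

(** Off the singular directions, length projects to a measure that is absolutely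
    continuous with respect to Lebesgue measure, and this measure controls the
    increments. *)
Lemma absolutely_continuous_radon_indic :
  hausdorff1 (boundary K) < +oo -> ~ singular_direction (boundary K) u ->
  absolutely_continuous (radon_indic u K).
Proof.
move=> fB nsu; have [nu nuE] := projected_measure fB u1.
have null E : measurable E -> lambda E = 0 -> nu E = 0.
  move=> mE E0; apply: contrapT => nuE0; apply: nsu; exists E; split=> //.
  rewrite -nuE lt_neqAle measure_ge0 andbT eq_sym; exact/eqP.
have dom : charge_of_finite_measure nu `<< lambda.
  by apply/null_content_dominatesP => E mE E0; exact: null.
move=> eps eps0.
have [P [N PN]] := Hahn_decomposition (charge_of_finite_measure nu).
have [d [d0 hd]] := charge_variation_continuous PN dom eps0.
exists d => // n a b ab tab sd.
pose J (i : 'I_n) := `]a i, b i[%classic : set (measurableTypeR R).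
have mJ i : measurable (J i) by exact: measurable_itv.
have nu1 (c : R) : nu [set c] = 0.
  by apply: null => //; rewrite lebesgue_measure_set1.
(* points are null for nu, so passing to the open interval loses nothing *)
have step i : `|radon_indic u K (b i) - radon_indic u K (a i)|%:E <= nu (J i).
  rewrite (le_trans (radon_indic_dist (ab i)))// -nuE.
  apply: (@le_trans _ _ (nu (J i `|` [set a i] `|` [set b i]))).
    apply: le_measure; rewrite ?inE//.
      by apply: measurableU => //; exact: measurableU.
    move=> r /=; rewrite !in_itv/= !le_eqVlt => /andP[].
    by move=> /predU1P[<-|ar] /predU1P[->|rb]; [right|left; right|right|
      left; left; rewrite /J /= in_itv/= ar].
  apply: (@le_trans _ _ (nu (J i) + nu [set a i] + nu [set b i])).
    rewrite (le_trans (measureU2 _ _ _))//; first exact: measurableU.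
    by rewrite leeD2r// measureU2.
  by rewrite !nu1 !adde0.
rewrite -lte_fin -sumEFin.
apply: (@le_lt_trans _ _ (\sum_(i < n) nu (J i))); first by apply: lee_sum.
rewrite -(@measure_bigsetU_ord _ _ _ nu n xpredT J)//.
have mU : measurable (\big[setU/set0]_(i < n) J i) by exact: bigsetU_measurable.
apply: le_lt_trans (hd _ mU _).
  apply: le_trans (abse_charge_variation PN mU); exact: lee_abs.
rewrite (@measure_bigsetU_ord _ _ _ lambda n xpredT J)//.
apply: le_lt_trans (_ : (\sum_(i < n) (b i - a i))%:E < d%:E); last by rewrite lte_fin.
rewrite -sumEFin; apply: lee_sum => i _.
by rewrite /J /= lebesgue_measure_itv/= lte_fin; case: ltP => // _;
  rewrite lee_fin subr_ge0.
Qed.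

End slices.

Theorem theorem5p12 (R : realType) (K : set (R * R)) (cK : compact K)
  (rK : rectifiable (boundary K)) (fK : (hausdorff1 (boundary K) < +oo)%E) :
  countable [set theta : R * R |
    unit_circle R theta /\ ~ absolutely_continuous (radon_indic theta K)].
Proof.
apply: sub_countable (countable_singular_circle fK rK).
apply: subset_card_le => u [u1 nac]; split=> //.
by apply: contrapT => nsu; apply: nac; exact: absolutely_continuous_radon_indic.
Qed.
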